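(* The Segre-Veronese variety $SV^{(1,1,n)}_{(1,d,1)}$ is $h$-defective for each of the following triples $(n,d,h)$: $(3,3,5)$, $(3,6,9)$, $(3,9,13)$, $(4,4,7)$, $(4,7,11)$, $(5,4,7)$, $(5,5,9)$.
   Context: All varieties are over $\mathbb{C}$. $SV^{(n_1,\dots,n_r)}_{(d_1,\dots,d_r)}\subseteq\mathbb{P}^N$, with $N=\prod_{i=1}^r\binom{n_i+d_i}{d_i}-1$, is the image of $\mathbb{P}^{n_1}\times\dots\times\mathbb{P}^{n_r}$ under the embedding induced by the complete linear system $|\mathcal{O}_{\mathbb{P}^{n_1}\times\dots\times\mathbb{P}^{n_r}}(d_1,\dots,d_r)|$. For an irreducible non-degenerate $n$-dimensional variety $X\subseteq\mathbb{P}^N$ and $h\geq 1$, the $h$-secant variety $\mathrm{Sec}_h(X)$ is the Zariski closure of the union of all linear spaces spanned by collections of $h$ points of $X$; its expected dimension is $\min\{nh+h-1,N\}$. $X$ is $h$-defective if $\dim \mathrm{Sec}_h(X)$ is strictly smaller than the expected dimension. *)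

(* Defs.v *)
From mathcomp Require Import all_boot all_order all_algebra.
From mathcomp Require Import classical_sets mpoly.

Set Implicit Arguments.
Unset Strict Implicit.
Unset Printing Implicit Defensive.

Import GRing.Theory.
Local Open Scope ring_scope.
Local Open Scope classical_set_scope.

Section ProjectiveSpace.
Variables (K : fieldType) (N : nat).

(* A point of P^N is a line through the origin of K^(N+1). *)
Definition proj := {U : {vspace 'rV[K]_N.+1} | \dim U == 1%N}.

Definition vanish_at (f : {mpoly K[N.+1]}) (p : proj) : Prop :=
  forall v : 'rV[K]_N.+1, v \in val p -> f.@[v 0] = 0.

Definition zclosed (A : set proj) : Prop :=
  exists2 S : set {mpoly K[N.+1]},
    (forall f, S f -> exists e : nat, f \is e.-homog)
    & A = [set p | forall f, S f -> vanish_at f p].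

Definition zclosure (Y : set proj) : set proj :=
  \bigcap_(A in [set A | zclosed A /\ Y `<=` A]) A.

Definition closed_in (X Y : set proj) : Prop :=
  exists2 A, zclosed A & Y = X `&` A.

Definition zirreducible (Y : set proj) : Prop :=
  Y !=set0 /\
  forall A B, closed_in Y A -> closed_in Y B -> Y = A `|` B -> Y = A \/ Y = B.

Definition irr_chain (X : set proj) (m : nat) : Prop :=
  exists Z : nat -> set proj,
    (forall i, (i <= m)%N -> closed_in X (Z i) /\ zirreducible (Z i)) /\
    (forall i, (i < m)%N -> Z i `<` Z i.+1).

(* Krull dimension of X with the topology induced by the Zariski topology *)
Definition has_dim (X : set proj) (k : nat) : Prop :=
  irr_chain X k /\ forall m, irr_chain X m -> (m <= k)%N.

Definition secant (h : nat) (X : set proj) : set proj :=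
  zclosure [set q | exists2 p : 'I_h -> proj,
    (forall i, X (p i)) & (val q <= \sum_(i < h) val (p i))%VS].

Definition expected_dim (n h : nat) : nat := minn (n * h + h - 1)%N N.

Definition defective (X : set proj) (h : nat) : Prop :=
  exists n s, [/\ has_dim X n, has_dim (secant h X) s
                & (s < expected_dim n h)%N].

End ProjectiveSpace.

(* exponents of the monomials of degree d in n + 1 variables *)
Definition monom (n d : nat) :=
  {t : n.+1.-tuple 'I_d.+1 | \sum_(j <- t) j == d}%N.

Lemma card_monom n d : #|{: monom n d}| = 'C(n + d, d).
Proof.
rewrite card_sig -(bin_sub (leq_addl n d)) addnK -card_ord_partitions.
by rewrite cardsE; apply: eq_card.
Qed.

Section SegreVeronese.
Variables (K : fieldType) (r : nat) (n d : r.-tuple nat).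

(* exponents of the monomials of multidegree d, which form a basis of the
   sections of O(d_1, ..., d_r) *)
Definition multimonom := {dffun forall i : 'I_r, monom (tnth n i) (tnth d i)}.

Definition SVN : nat :=
  (\prod_(i < r) 'C(tnth n i + tnth d i, tnth d i)).-1%N.

Lemma card_multimonom : #|{: multimonom}| = SVN.+1.
Proof.
rewrite /SVN prednK; last first.
  by apply: prodn_gt0 => i; rewrite bin_gt0 leq_addl.
rewrite card_dep_ffun foldrE big_image /=.
by apply: eq_bigr => i _; rewrite card_monom.
Qed.

Definition SV_monom (k : 'I_SVN.+1) : multimonom :=
  enum_val (cast_ord (esym card_multimonom) k).

Definition SV_map (x : forall i : 'I_r, 'rV[K]_(tnth n i).+1) :
    'rV[K]_SVN.+1 :=
  \row_k \prod_(i < r) \prod_(j < (tnth n i).+1)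
    x i 0 j ^+ tnth (val (SV_monom k i)) j.

Definition SV : set (proj K SVN) :=
  [set p | exists2 x : forall i : 'I_r, 'rV[K]_(tnth n i).+1,
     (forall i, x i != 0) & val p = <[SV_map x]>%VS].

End SegreVeronese.

Arguments SV K {r} n d.

(* Main.v *)
Require Import Defs.
From mathcomp Require Import all_boot all_order all_algebra.
From mathcomp Require Import reals complex.
From mathcomp Require Import classical_sets boolp mpoly.
From mathcomp Require Import ring zify.

(** The numbers [h] of the seven cases are odd, [h = 2 * q + 1]. Forms [f0] and
    [f1] of degree [q] in two variables have together [2 * q + 2] coefficients,
    so [2 * q + 1] general points [(x_i, y_i)] of P^1 x P^1 lie on the graph
    [x = (f0 y : f1 y)] of such a pair, a rational curve C of bidegree (1, q).
    The restriction of O(1, d) to C has degree [d + q], so C x P^n spans a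
    linear space of dimension at most [(d + q + 1) * (n + 1) - 1], and this space
    contains the span of every set of [h] points of C x P^n. As the curves C form
    a family of dimension [2 * q + 1], the secant variety has dimension at most
    [2 * q + (d + q + 1) * (n + 1)], which in each of the seven cases is less
    than the expected dimension.

    In coordinates, a tensor of the span of C x P^n has at the triple (a, b, c),
    where [0 <= a <= 1], [0 <= b <= d] and [0 <= c <= n], the entry
    [sum_s f_(a, s) * u_(b + s, c)], where [f_(a, s)] are the coefficients of
    [f_a] and [u] is an arbitrary tensor on C x P^n ([curve_tensor]). This map is
    linear in [f] and in [u], so one coordinate of each can be set to 1 without
    changing the closure of the image ([affine_curve_tensorP]). The secant variety
    is contained in that closure ([secant_vanish]): a degenerate configuration of
    points is joined by a line to one for which the interpolation problem for
    [(f0, f1)] is well posed, and a polynomial which vanishes at almost all points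
    of the line vanishes on it ([secant_tensor_vanish]).

    Dimensions being lengths of chains of irreducible closed sets, two facts on
    chains complete the proof. A set in the closure of the image of an affine
    space of dimension [m] under a polynomial map has no chain longer than [m]
    ([irr_chain_param]), because the Hilbert function of the top of a chain of
    length [l] grows at least like a polynomial of degree [l], while the forms of
    degree [e] pulled back to the affine space span a space of dimension
    [O(e ^ m)]. In the other direction, the expected dimension requires only that
    the Segre-Veronese variety have dimension at least [n + 2], and the images of
    nested products of coordinate subspaces form a chain of that length
    ([SV_chain3]). *)

Set Implicit Arguments.
Unset Strict Implicit.
Unset Printing Implicit Defensive.

Import Order.TTheory GRing.Theory Num.Theory.

(** * Vanishing of forms and Hilbert functions *)

Section Vanishing.
Variables (K : fieldType) (N : nat).
Local Open Scope ring_scope.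
Implicit Types (f g : {mpoly K[N.+1]}) (p : proj K N).

Lemma meval_homogZ e f (c : K) (v : 'I_N.+1 -> K) : f \is e.-homog ->
  f.@[fun i => c * v i] = c ^+ e * f.@[v].
Proof.
move=> /dhomogP fe; rewrite !mevalE mulr_sumr; apply: eq_big_seq => m /fe /= me.
rewrite mulrCA; congr (_ * _).
rewrite (eq_bigr (fun i => c ^+ m i * v i ^+ m i)) => [|i _]; last exact: exprMn.
by rewrite big_split /= prodrXr -me mdegE.
Qed.

Lemma homogX (k : 'I_N.+1) : 'X_k \is [in K[N.+1], 1.-homog].
Proof. by rewrite dhomogX /= mdeg1. Qed.

Lemma proj_rep p : exists2 v : 'rV[K]_N.+1, v != 0 & val p = <[v]>%VS.
Proof.
exists (vpick (val p)).
  by rewrite vpick0 -dimv_eq0 (eqP (valP p)).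
apply/esym/eqP; rewrite eqEdim -memvE memv_pick dim_vline vpick0 -dimv_eq0.
by rewrite (eqP (valP p)).
Qed.

Lemma proj_of_vec (v : 'rV[K]_N.+1) : v != 0 ->
  exists p : proj K N, val p = <[v]>%VS.
Proof.
move=> v0; have dv : \dim <[v]>%VS == 1%N by rewrite dim_vline v0.
by exists (exist (fun U => \dim U == 1%N) _ dv).
Qed.

Lemma vanish_at_line e f p (v : 'rV[K]_N.+1) : f \is e.-homog ->
  val p = <[v]>%VS -> vanish_at f p <-> f.@[v 0] = 0.
Proof.
move=> fe pv; split=> [fp|fv u]; first by apply: fp; rewrite pv memv_line.
rewrite pv => /vlineP[c ->].
rewrite (meval_eq (v2 := fun i => c * v 0 i)) => [|i]; last by rewrite mxE.
by rewrite (meval_homogZ _ _ fe) fv mulr0.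
Qed.

Lemma vanish_atM d e f g p : f \is d.-homog -> g \is e.-homog ->
  vanish_at (f * g) p -> vanish_at f p \/ vanish_at g p.
Proof.
move=> fd ge; have [v _ pv] := proj_rep p.
rewrite (vanish_at_line (dhomogM fd ge) pv) (vanish_at_line fd pv).
rewrite (vanish_at_line ge pv) mevalM => /eqP; rewrite mulf_eq0.
by case/orP=> /eqP; [left | right].
Qed.

Lemma zclosed_hypersurface e f : f \is e.-homog ->
  zclosed [set p | vanish_at f p]%classic.
Proof.
move=> fe; exists [set f]%classic; first by move=> _ ->; exists e.
by apply/seteqP; split=> p /= => [fp _ -> | ]; [|exact].
Qed.

(** The ideal of an irreducible set is prime, as far as forms are concerned. *)
Lemma zirreducibleM (Z : set (proj K N)) d e f g :
  zirreducible Z -> f \is d.-homog -> g \is e.-homog ->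
  (forall p, Z p -> vanish_at (f * g) p) ->
  (forall p, Z p -> vanish_at f p) \/ (forall p, Z p -> vanish_at g p).
Proof.
move=> [_ Zirr] fd ge fgZ.
have cl k (q : {mpoly K[N.+1]}) : q \is k.-homog ->
    closed_in Z (Z `&` [set p | vanish_at q p])%classic.
  move=> qk; exists [set p | vanish_at q p]%classic => //.
  exact: zclosed_hypersurface qk.
have cover : Z = ((Z `&` [set p | vanish_at f p]) `|`
                  (Z `&` [set p | vanish_at g p]))%classic.
  apply/seteqP; split=> p /=; last by case=> -[].
  by move=> Zp; case: (vanish_atM fd ge (fgZ p Zp)); [left | right].
case: (Zirr _ _ (cl _ _ fd) (cl _ _ ge) cover) => ->; first by left=> p [].
by right=> p [].
Qed.

Lemma closed_in_separate (Y Z : set (proj K N)) p : closed_in Y Z -> Y p ->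
  ~ Z p -> exists e f, [/\ f \is e.-homog, forall q, Z q -> vanish_at f q
    & ~ vanish_at f p].
Proof.
move=> [A [S Shom ->] ->] Yp nZp.
have /existsNP[f /not_implyP[Sf nfp]] : ~ (forall f, S f -> vanish_at f p).
  by move=> Ap; apply: nZp; split.
have [e fe] := Shom f Sf.
by exists e, f; split=> // q [_]; apply.
Qed.

Lemma zclosure_vanish (Y : set (proj K N)) e f : f \is e.-homog ->
  (forall p, Y p -> vanish_at f p) ->
  forall p, zclosure Y p -> vanish_at f p.
Proof.
move=> fe fY p; apply; split; first exact: zclosed_hypersurface fe.
by move=> q /fY.
Qed.

(** The Hilbert function of [Z] at [e] is at least [c]. Indexing the family by
    an arbitrary finite type makes weakening [c] and taking disjoint unions of
    families immediate. *)
Definition hilbert_ge (Z : set (proj K N)) (e c : nat) : Prop :=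
  exists2 I : finType, (c <= #|I|)%N & exists2 F : I -> {mpoly K[N.+1]},
    forall i, F i \is e.-homog
    & forall a : I -> K,
      (forall p, Z p -> vanish_at (\sum_i a i *: F i) p) -> forall i, a i = 0.

Lemma hilbert_ge_leq Z e c c' : (c' <= c)%N -> hilbert_ge Z e c ->
  hilbert_ge Z e c'.
Proof. by move=> cc [I cI HF]; exists I => //; exact: leq_trans cI. Qed.

Lemma hilbert_ge_point Z p e : Z p -> hilbert_ge Z e 1.
Proof.
move=> Zp; have [v v0 pv] := proj_rep p.
have /rV0Pn[k vk] := v0.
have Xe : 'X_k ^+ e \is [in K[N.+1], e.-homog].
  by rewrite -[e in e.-homog]mul1n; exact/dhomogMn/homogX.
exists unit; first by rewrite card_unit.
exists (fun=> 'X_k ^+ e) => // a /(_ p Zp).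
rewrite (big_pred1 tt) => [|[]//].
have aXe : a tt *: 'X_k ^+ e \is [in K[N.+1], e.-homog] by exact: dhomogZ.
rewrite (vanish_at_line aXe pv) mevalZ rmorphXn /= mevalXU => /eqP.
by rewrite mulf_eq0 expf_eq0 (negPf vk) andbF orbF => /eqP a0 [].
Qed.

(** Multiplication by [f] maps the coordinate ring of [Z'] injectively into the
    kernel of its restriction to [Z]. Hence lifts of forms independent on [Z],
    together with multiples by [f] of forms independent on [Z'], are independent
    on [Z']. *)
Lemma hilbert_ge_step (Z Z' : set (proj K N)) d f e c c' :
  (Z `<=` Z')%classic -> zirreducible Z' -> f \is d.-homog ->
  (forall p, Z p -> vanish_at f p) -> (exists2 p, Z' p & ~ vanish_at f p) ->
  hilbert_ge Z (d + e) c -> hilbert_ge Z' e c' -> hilbert_ge Z' (d + e) (c + c').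
Proof.
move=> sZ irr fd fZ [p0 Zp0 nfp0] [I cI [F Fh Find]] [J cJ [G Gh Gind]].
exists (I + J)%type; first by rewrite card_sum leq_add.
exists (fun k => match k with inl i => F i | inr j => f * G j end).
  by move=> [i|j]; [exact: Fh | exact: dhomogM].
move=> b bZ.
have split_sum : \sum_k b k *: (match k with inl i => F i | inr j => f * G j end)
    = \sum_i b (inl i) *: F i + f * \sum_j b (inr j) *: G j.
  rewrite big_sumType /=; congr (_ + _).
  by rewrite mulr_sumr; apply: eq_bigr => j _; rewrite scalerAr.
rewrite split_sum in bZ.
have b0 i : b (inl i) = 0.
  apply: (Find (fun i => b (inl i))) => p Zp v vp.
  move: (bZ p (sZ p Zp) v vp).
  by rewrite mevalD mevalM (fZ p Zp v vp) mul0r addr0.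
move=> [//|]; apply: Gind.
have fG0 p : Z' p -> vanish_at (f * \sum_j b (inr j) *: G j) p.
  move=> Zp v vp; move: (bZ p Zp v vp); rewrite big1 ?add0r // => i _.
  by rewrite b0 scale0r.
have Gh' : \sum_j b (inr j) *: G j \is e.-homog.
  by apply: rpred_sum => j _; apply: dhomogZ.
case: (zirreducibleM irr fd Gh' fG0) => // f0.
by case: nfp0; exact: f0.
Qed.

(** Summing the inequality of [hilbert_ge_step] over the degrees divisible by the
    degree of [f] raises the degree of growth by one at each link of the chain.
    Only degrees divisible by [A] are considered because the forms which separate
    consecutive members have no common degree; powers of them do. *)
Lemma hilbert_ge_chain (Y : set (proj K N)) (Z : nat -> set (proj K N)) m :
  (forall i, (i <= m)%N -> closed_in Y (Z i) /\ zirreducible (Z i)) ->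
  (forall i, (i < m)%N -> (Z i `<` Z i.+1)%classic) ->
  exists2 A, (0 < A)%N & forall q, hilbert_ge (Z m) (A * q) 'C(q + m, m).
Proof.
elim: m => [|m IH] Zirr Zlt.
  have [_ [[p Zp] _]] := Zirr 0%N (leqnn _).
  by exists 1%N => // q; rewrite bin0; exact: hilbert_ge_point Zp.
have [A A0 HA] : exists2 A, (0 < A)%N &
    forall q, hilbert_ge (Z m) (A * q) 'C(q + m, m).
  by apply: IH => i im; [apply: Zirr; exact: leqW | apply: Zlt; exact: leqW].
have [Zcl _] := Zirr m (leqnSn m).
have [[A' _ ZA'] irr'] := Zirr m.+1 (leqnn _).
have [sZ /existsNP[p /not_implyP[Z'p nZp]]] := Zlt m (leqnn _).
have Yp : Y p by move: Z'p; rewrite ZA' => -[].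
have [d [f [fd fZ nfp]]] := closed_in_separate Zcl Yp nZp.
have d0 : (0 < d)%N.
  rewrite lt0n; apply: contra_notN nfp => /eqP d0; rewrite d0 in fd.
  have [_ [[p0 Zp0] _]] := Zirr m (leqnSn m).
  have [w _ pw] := proj_rep p; rewrite (vanish_at_line fd pw).
  (* a form of degree 0 takes at w the value it takes at the origin *)
  have := meval_homogZ 0 (w 0) fd; rewrite expr0 mul1r => <-.
  have f0 := fZ _ Zp0 0 (mem0v _).
  by rewrite -[RHS]f0; apply: meval_eq => i; rewrite mul0r mxE.
have fAd : f ^+ A \is (d * A).-homog by exact: dhomogMn.
have fAZ q : Z m q -> vanish_at (f ^+ A) q.
  by move=> Zq v vq; rewrite -(prednK A0) exprS mevalM (fZ q Zq v vq) mul0r.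
have nfAp : ~ vanish_at (f ^+ A) p.
  have [w _ pw] := proj_rep p; rewrite (vanish_at_line fAd pw) => /eqP.
  rewrite rmorphXn expf_eq0 A0 /= => /eqP fw0; apply: nfp.
  exact/(vanish_at_line fd pw).
exists (d * A)%N; first by rewrite muln_gt0 d0.
(* Pascal's rule adds up the contributions of the multiples of f ^ A *)
elim=> [|q IHq]; first by rewrite muln0 binn; exact: hilbert_ge_point Z'p.
rewrite -addSnnS addSn binS addnC mulnS.
apply: (hilbert_ge_step sZ irr' fAd fAZ); first by exists p.
  rewrite -mulnS mulnC mulnA mulnC; apply: hilbert_ge_leq (HA _).
  by apply: leq_bin2l; nia.
by rewrite addSnnS.
Qed.
End Vanishing.

(** * Dimension of the closure of the image of a polynomial map *)

Section Substitution.
Variables (K : fieldType) (m N B : nat).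
Local Open Scope ring_scope.

Lemma msize_prod_exp (I : finType) (p : I -> {mpoly K[m]}) (e : I -> nat) :
  (forall i, msize (p i) <= B.+1)%N ->
  (msize (\prod_i p i ^+ e i) <= (B * \sum_i e i).+1)%N.
Proof.
move=> pB.
have degM (f g : {mpoly K[m]}) c d : (msize f <= c.+1)%N -> (msize g <= d.+1)%N ->
    (msize (f * g)%R <= (c + d).+1)%N.
  move=> fc gd; have [->|f0] := eqVneq f 0; first by rewrite mul0r msize0.
  have [->|g0] := eqVneq g 0; first by rewrite mulr0 msize0.
  rewrite msizeM //; move: (msize f) (msize g) fc gd => x y; lia.
have degX i k : (msize (p i ^+ k)%R <= (B * k).+1)%N.
  elim: k => [|k IH]; first by rewrite expr0 msize1 muln0.
  by rewrite exprS mulnS; exact: degM.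
rewrite big_distrr /=.
elim/big_rec2: _ => [|i d f _ IH]; first by rewrite msize1.
exact: degM.
Qed.

Lemma msize_comp_homog e (F : {mpoly K[N]}) (phi : N.-tuple {mpoly K[m]}) :
  F \is e.-homog -> (forall i, msize (tnth phi i) <= B.+1)%N ->
  (msize (F \mPo phi) <= (B * e).+1)%N.
Proof.
move=> /dhomogP Fe phiB; rewrite comp_mpolyE.
apply: leq_trans (msize_sum _ _ _) _; rewrite big_seq.
elim/big_ind: _ => // [x y xB yB|u /Fe /= eu]; first by rewrite geq_max xB.
apply: leq_trans (msizeZ_le _ _) _; apply: leq_trans (msize_prod_exp _ phiB) _.
by rewrite -mdegE eu.
Qed.

End Substitution.

Section LinearDependence.
Variables (K : fieldType) (m : nat).
Local Open Scope ring_scope.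

Lemma card_bmultinom b : (#|{: 'X_{1..m < b}}| <= b ^ m)%N.
Proof.
rewrite -[X in (_ <= X ^ _)%N]card_ord -[X in (_ <= _ ^ X)%N]card_ord -card_ffun.
have lt (u : 'X_{1..m < b}) i : (bmnm u i < b)%N.
  apply: leq_ltn_trans (bmdeg u); rewrite mdegE (bigD1 i) //=.
  exact: leq_addr.
apply: (leq_card (fun u : 'X_{1..m < b} => [ffun i => Ordinal (lt u i)])).
move=> u v uv; apply/val_inj/mnmP => i.
by move/ffunP/(_ i): uv; rewrite !ffunE => -[].
Qed.

(** There are at most [b ^ m] monomials of degree less than [b], so a larger
    family is dependent. *)
Lemma mpoly_lin_dep (I : finType) b (G : I -> {mpoly K[m]}) :
  (forall i, msize (G i) <= b)%N -> (b ^ m < #|I|)%N ->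
  exists2 a : I -> K, \sum_i a i *: G i = 0 & exists i, a i != 0.
Proof.
move=> Gb bI; pose M : finType := 'X_{1..m < b}.
pose A : 'M[K]_(#|I|, #|M|) :=
  \matrix_(i, j) (G (enum_val i))@_(bmnm (enum_val j : 'X_{1..m < b})).
have : kermx A != 0.
  rewrite kermx_eq0 /row_free neq_ltn; apply/orP; left.
  apply: leq_ltn_trans (rank_leq_col A) _.
  exact: leq_ltn_trans (card_bmultinom b) bI.
move=> /rowV0Pn[v /sub_kermxP vA v0].
exists (fun i => v 0 (enum_rank i)); last first.
  by have /rV0Pn[i vi] := v0; exists (enum_val i); rewrite enum_valK.
under eq_bigr => i _ do rewrite (mpolywE (Gb i)) scaler_sumr.
rewrite exchange_big big1 //= => u _.
under eq_bigr => i _ do rewrite scalerA.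
rewrite -scaler_suml; move/rowP/(_ (enum_rank u)): vA; rewrite !mxE => vAu.
rewrite (reindex_onto enum_val enum_rank) => [|i _]; last exact: enum_rankK.
under eq_bigl => i do rewrite enum_valK eqxx.
rewrite [X in X *: _](_ : _ = 0) ?scale0r // -[RHS]vAu.
by apply: eq_bigr => i _; rewrite !mxE enum_valK enum_rankK.
Qed.
End LinearDependence.

Section Growth.

(** The left side has degree [m] in [q] and the right side degree [l]; the
    witness comes from ['C(q + l, l) * l`! >= q.+1 ^ l]. *)
Lemma bin_outgrows l m C : (m < l)%N ->
  exists q, ((C * q.+1) ^ m < 'C(q + l, l))%N.
Proof.
move=> ml; have lower k : forall q, (q.+1 ^ k <= (q + k) ^_ k)%N.
  elim: k => [|k IH] q //.
  by rewrite addnS ffactSS expnS leq_mul // ltnS leq_addr.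
pose q := (l`! * C ^ m)%N; exists q.
rewrite ltnNge; apply/negP => upper.
have : (q.+1 ^ l <= q * q.+1 ^ m)%N.
  apply: leq_trans (lower l q) _.
  by rewrite -bin_ffact mulnC /q -mulnA leq_mul // -expnMn.
rewrite leqNgt => /negP; apply.
rewrite -(subnKC ml) expnD expnS; apply: leq_trans (leq_pmulr _ _).
  by rewrite ltn_pmul2r ?expn_gt0.
by rewrite expn_gt0.
Qed.
End Growth.

Section Dimension.
Variables (K : fieldType) (N m : nat).
Local Open Scope ring_scope.

(** The hypothesis on [Y] says that [Y] lies in the closure of the image of [phi].
    Forms independent on the top of the chain stay independent when composed with
    [phi], so the growth given by [hilbert_ge_chain] is bounded by the number of
    monomials in [m] variables, which has degree [m] in [q]. *)
Lemma irr_chain_param (phi : N.+1.-tuple {mpoly K[m]}) (Y : set (proj K N)) l :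
  (forall e (F : {mpoly K[N.+1]}), F \is e.-homog ->
     (forall v : 'I_m -> K, F.@[fun k => (tnth phi k).@[v]] = 0) ->
     forall p, Y p -> vanish_at F p) ->
  irr_chain Y l -> (l <= m)%N.
Proof.
move=> Yphi [Z [Zirr Zlt]]; rewrite leqNgt; apply/negP => ml.
have [A A0 HA] := hilbert_ge_chain Zirr Zlt.
pose B := (\max_k msize (tnth phi k))%N.
have phiB k : (msize (tnth phi k) <= B.+1)%N.
  by apply: leqW; exact: (leq_bigmax k).
have [q Hq] := bin_outgrows (B * A).+1 ml.
have [I cI [F Fh Find]] := HA q.
have Fb i : (msize (F i \mPo phi) <= (B * A).+1 * q.+1)%N.
  by apply: leq_trans (msize_comp_homog (Fh i) phiB) _; nia.
have [a aF [i ai]] := mpoly_lin_dep Fb (leq_trans Hq cI).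
move/eqP: ai; apply; apply: Find => p Zp.
have Yp : Y p by have [[W _ ZE] _] := Zirr l (leqnn l); move: Zp; rewrite ZE => -[].
apply: Yphi Yp => [|v].
  by apply: rpred_sum => j _; apply: dhomogZ.
rewrite -comp_mpoly_meval -[RHS](meval0 v) -aF; congr (_.@[v]).
rewrite (raddf_sum (comp_mpoly phi)).
by apply: eq_bigr => j _; exact: comp_mpolyZ.
Qed.

End Dimension.

Section HasDim.
Variables (K : fieldType) (N : nat).

Lemma has_dim_exists (X : set (proj K N)) b l : irr_chain X l ->
  (forall k, irr_chain X k -> (k <= b)%N) ->
  exists2 k, has_dim X k & (l <= k <= b)%N.
Proof.
move=> Xl Xb.
have [t] := ubnP (b - l)%N; elim: t l Xl => // t IH l Xl ltb.
have [[j [Xj lj]]|nomore] := pselect (exists j, irr_chain X j /\ (l < j)%N).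
  have [|k Xk /andP[jk kb]] := IH j Xj; first by have := Xb _ Xj; lia.
  by exists k => //; rewrite kb (leq_trans (ltnW lj) jk).
exists l; last by rewrite leqnn Xb.
split=> // j Xj; rewrite leqNgt; apply/negP => lj; apply: nomore.
by exists j.
Qed.
End HasDim.

(** * Polynomials along curves *)

Section PolynomialCurves.
Variable K : numFieldType.
Local Open Scope ring_scope.

Lemma poly_eq0_fun (g : {poly K}) : (forall t, g.[t] = 0) -> g = 0.
Proof.
move=> g0; apply/eqP; apply: contraT => gn0.
have := @max_poly_roots _ g [seq i%:R | i <- iota 0 (size g)] gn0.
rewrite size_map size_iota ltnn; apply.
  by apply/allP => _ /mapP[i _ ->]; rewrite rootE g0.
by rewrite map_inj_uniq ?iota_uniq // => i j /eqP; rewrite eqr_nat => /eqP.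
Qed.

Lemma poly_eq0_dense (p g : {poly K}) : p != 0 ->
  (forall t, p.[t] != 0 -> g.[t] = 0) -> g = 0.
Proof.
move=> p0 pg; have /eqP : p * g = 0.
  apply: poly_eq0_fun => t; rewrite hornerM.
  by have [->|/pg ->] := eqVneq p.[t] 0; rewrite ?mul0r ?mulr0.
by rewrite mulf_eq0 (negPf p0) => /eqP.
Qed.

Lemma mpoly_curve N (F : {mpoly K[N]}) (c : 'I_N -> {poly K}) :
  exists g : {poly K}, forall t, g.[t] = F.@[fun k => (c k).[t]].
Proof.
exists (\sum_(m <- msupp F) F@_m *: \prod_i c i ^+ m i) => t.
rewrite mevalE horner_sum; apply: eq_bigr => m _.
rewrite hornerZ horner_prod; congr (_ * _); apply: eq_bigr => i _.
by rewrite horner_exp.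
Qed.

(** This replaces every density argument below: a closed condition is checked at
    the points of a curve outside the zeros of [p], where the configuration is
    general, and then holds at all its points. *)
Lemma meval_curve_eq0 N (F : {mpoly K[N]}) (c : 'I_N -> {poly K}) (p : {poly K}) :
  p != 0 -> (forall t, p.[t] != 0 -> F.@[fun k => (c k).[t]] = 0) ->
  forall t, F.@[fun k => (c k).[t]] = 0.
Proof.
move=> p0 pF t; have [g gE] := mpoly_curve F c; rewrite -gE.
suff -> : g = 0 by rewrite horner0.
by apply: (poly_eq0_dense p0) => u /pF; rewrite gE.
Qed.
End PolynomialCurves.

(** * Graphs of pairs of binary forms through points of P^1 x P^1 *)

Section BinaryForms.
Variable q : nat.
Local Open Scope ring_scope.
Local Notation h := (q + q.+1)%N.

Section Ring.
Variable A : comNzRingType.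
Implicit Types (x y : nat -> nat -> A) (w : nat -> A).

Definition bimonom y j s : A := y j 0%N ^+ (q - s) * y j 1%N ^+ s.

(** The value at [y j] of the form [f_a] of degree [q], for [a = 0, 1]; the
    sequence [w] lists the coefficients of [f_0] and then those of [f_1]. *)
Definition pencil w y a j : A :=
  \sum_(s < q.+1) w (a * q.+1 + s)%N * bimonom y j s.

(** The coefficient of [w r] in the linear condition on [w] that the point
    [(x j, y j)] lie on the graph of [(f_0 : f_1)]. *)
Definition on_graph x y r j : A :=
  if (r < q.+1)%N then x j 1%N * bimonom y j r
  else - (x j 0%N * bimonom y j (r - q.+1)).

(** The coefficients of the linear system on [w] which requires the graph to pass
    through all the points except the [i]-th and both [f_0] and [f_1] to vanish
    at [y i]. If it has no nonzero solution, a pair of forms whose graph passes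
    through all the points cannot vanish at [y i]. *)
Definition incidence x y i r j : A :=
  if j == i then (if (r < q.+1)%N then bimonom y i r else 0)
  else if j == h then (if (r < q.+1)%N then 0 else bimonom y i (r - q.+1))
  else on_graph x y r j.

Definition incidence_mx x y i : 'M[A]_(q.+1 + q.+1) :=
  \matrix_(r, j) incidence x y i r j.

Lemma sum_two_forms w (G H : nat -> A) :
  \sum_(r < q.+1 + q.+1)
     w r * (if (r < q.+1)%N then G r else H (r - q.+1)%N) =
  \sum_(s < q.+1) w (0 * q.+1 + s)%N * G s +
  \sum_(s < q.+1) w (1 * q.+1 + s)%N * H s.
Proof.
rewrite big_split_ord /=; congr (_ + _); apply: eq_bigr => r _.
  by rewrite ltn_ord.
by rewrite ltnNge leq_addr /= mul1n addKn.
Qed.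

Lemma sum_on_graph x y w j :
  \sum_(r < q.+1 + q.+1) w r * on_graph x y r j =
  x j 1%N * pencil w y 0 j - x j 0%N * pencil w y 1 j.
Proof.
apply: etrans (sum_two_forms w (fun s => x j 1%N * bimonom y j s)
  (fun s => - (x j 0%N * bimonom y j s))) _.
rewrite /pencil !mulr_sumr -sumrN; congr (_ + _); apply: eq_bigr => r _.
  by rewrite mulrCA.
by rewrite mulrN mulrCA.
Qed.

Lemma mul_incidence_mx x y w i (j : 'I_(q.+1 + q.+1)) :
  ((\row_r w r) *m incidence_mx x y i) 0 j =
  if j == i :> nat then pencil w y 0 i
  else if j == h :> nat then pencil w y 1 i
  else x j 1%N * pencil w y 0 j - x j 0%N * pencil w y 1 j.
Proof.
rewrite mxE; under eq_bigr => r _ do rewrite !mxE /incidence.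
case: eqP => _; last (case: eqP => _; last exact: sum_on_graph).
  apply: etrans (sum_two_forms w (bimonom y i) (fun=> 0)) _.
  rewrite [X in _ + X]big1 ?addr0 // => r _.
  by rewrite mulr0.
apply: etrans (sum_two_forms w (fun=> 0) (bimonom y i)) _.
rewrite big1 ?add0r // => r _.
by rewrite mulr0.
Qed.
End Ring.

Lemma horner_incidence_mx (K : fieldType) (x y : nat -> nat -> {poly K}) i t :
  (\det (incidence_mx x y i)).[t] =
  \det (incidence_mx (fun j a => (x j a).[t]) (fun j a => (y j a).[t]) i).
Proof.
apply: etrans (esym (det_map_mx (horner_eval t) (incidence_mx x y i))) _.
congr (\det _).
apply/matrixP => r j; rewrite !mxE /= /incidence /on_graph /bimonom /horner_eval.
case: eqP => _; last case: eqP => _; case: ifP => _;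
  by rewrite ?horner0 ?hornerN ?hornerM ?horner_exp.
Qed.

Section Field.
Variable K : fieldType.
Implicit Types (x y : nat -> nat -> K).

(** There is one more coefficient than there are conditions, whence a nonzero
    [w]; the determinants exclude common zeros of [f_0] and [f_1] at the [y i],
    where the condition of lying on the graph would be empty. *)
Lemma pencil_through x y :
  (forall i, (i < h)%N -> \det (incidence_mx x y i) != 0) ->
  exists w : nat -> K, forall i, (i < h)%N -> exists mu,
    forall a, (a < 2)%N -> x i a = mu * pencil w y a i.
Proof.
move=> xy_gen.
pose M : 'M[K]_(q.+1 + q.+1, h) := \matrix_(r, j) on_graph x y r j.
have : kermx M != 0.
  rewrite kermx_eq0 /row_free neq_ltn; apply/orP; left.
  by apply: leq_ltn_trans (rank_leq_col M) _; rewrite addSn.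
move=> /rowV0Pn[v /sub_kermxP vM v0].
pose w r := v 0 (inord r : 'I_(q + q.+1).+1).
have wE : \row_r w r = v by apply/rowP => r; rewrite mxE /w inord_val.
have cond i : (i < h)%N -> x i 1%N * pencil w y 0 i = x i 0%N * pencil w y 1 i.
  move=> ih; apply/eqP; rewrite -subr_eq0 -sum_on_graph; apply/eqP.
  move/rowP/(_ (Ordinal ih)): vM; rewrite -wE !mxE => vM.
  by apply: etrans vM; apply: eq_bigr => r _; rewrite !mxE.
exists w => i ih.
have [f0|f0] := eqVneq (pencil w y 0 i) 0; last first.
  exists (x i 0%N / pencil w y 0 i) => -[|[|//]] _; first by rewrite divfK.
  by rewrite mulrAC -cond // mulfK.
have [f1|f1] := eqVneq (pencil w y 1 i) 0; last first.
  exists (x i 1%N / pencil w y 1 i) => -[|[|//]] _; last by rewrite divfK.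
  by rewrite mulrAC cond // mulfK.
have /negP[] := xy_gen i ih; apply/det0P; exists v => //.
apply/rowP => k; rewrite -wE mul_incidence_mx f0 f1 mxE.
case: eqP => // _; case: eqP => // kh.
by rewrite cond ?subrr //; have := ltn_ord k; lia.
Qed.
End Field.

Section BaseConfiguration.
Variable K : numFieldType.

(** A configuration with nonzero determinants: the points [y_j = (1 : j)], where
    [x_j] is (1 : 0) for the first [q] of them, (0 : 1) for the next [q] and
    (1 : 1) for the last. The conditions become zeros of [f_1], zeros of [f_0] and
    one equality of values. *)
Definition base_x (j a : nat) : K :=
  if (j < q)%N then (a == 0)%:R else if (j < q + q)%N then (a == 1)%:R else 1.

Definition base_y (j a : nat) : K := if a is 0%N then 1 else j%:R.

Lemma base_pencilE w a j :
  pencil w base_y a j = (\poly_(s < q.+1) w (a * q.+1 + s)%N).[j%:R].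
Proof.
rewrite horner_poly; apply: eq_bigr => s _.
by rewrite /bimonom /base_y expr1n mul1r.
Qed.

Lemma base_pencil_eq0 (w : nat -> K) a (s : seq nat) : uniq s -> (q < size s)%N ->
  (forall j, j \in s -> pencil w base_y a j = 0) ->
  forall r, (r < q.+1)%N -> w (a * q.+1 + r)%N = 0.
Proof.
move=> us qs ws r rq; set P := \poly_(s < q.+1) w (a * q.+1 + s)%N.
suff P0 : P = 0 by have := coef_poly q.+1 (fun s => w (a * q.+1 + s)%N) r;
  rewrite -/P P0 coef0 rq.
apply/eqP; apply: contraT => Pn0.
have := @max_poly_roots _ P [seq i%:R | i <- s] Pn0.
rewrite size_map ltnNge (leq_trans (size_poly _ _) qs); apply.
  by apply/allP => _ /mapP[i si ->]; rewrite rootE -base_pencilE ws.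
by rewrite map_inj_uniq // => i j /eqP; rewrite eqr_nat => /eqP.
Qed.

(** One more zero at [y i] gives one of [f_0], [f_1] as many as [q + 1] zeros,
    so it is zero; the equality at the last point then provides the missing zero
    of the other one. *)
Lemma base_generic i : (i < h)%N -> \det (incidence_mx base_x base_y i) != 0.
Proof.
move=> ih; apply/negP => /det0P[v v0 vM].
pose w r := v 0 (inord r : 'I_(q + q.+1).+1).
have wE : \row_r w r = v by apply/rowP => r; rewrite mxE /w inord_val.
have ev j : (j <= h)%N -> (if j == i :> nat then pencil w base_y 0 i
  else if j == h :> nat then pencil w base_y 1 i
  else base_x j 1%N * pencil w base_y 0 j - base_x j 0%N * pencil w base_y 1 j) = 0.
  move=> jh; have jlt : (j < q.+1 + q.+1)%N by lia.
  by rewrite -(mul_incidence_mx _ _ _ _ (Ordinal jlt)) wE vM mxE.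
have f0i : pencil w base_y 0 i = 0 by have := ev i (ltnW ih); rewrite eqxx.
have f1i : pencil w base_y 1 i = 0.
  by have := ev h (leqnn _); rewrite gtn_eqF // eqxx.
have cond j : (j < h)%N -> base_x j 1%N * pencil w base_y 0 j =
    base_x j 0%N * pencil w base_y 1 j.
  move=> jh; have [->|ji] := eqVneq j i; first by rewrite f0i f1i !mulr0.
  have := ev j (ltnW jh); rewrite (negPf ji) ltn_eqF // => /eqP.
  by rewrite subr_eq0 => /eqP.
have f1_lo j : (j < q)%N -> pencil w base_y 1 j = 0.
  move=> jq; have := cond j; rewrite /base_x jq mul0r mul1r => <- //; lia.
have f0_hi j : (q <= j < q + q)%N -> pencil w base_y 0 j = 0.
  move=> /andP[qj jq]; have := cond j.
  by rewrite /base_x (ltnNge j q) qj jq /= mul0r mul1r => -> //; lia.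
have last_eq : pencil w base_y 0 (q + q) = pencil w base_y 1 (q + q).
  have := cond (q + q)%N.
  by rewrite /base_x (ltnNge (q + q)%N q) leq_addr ltnn /= !mul1r => -> //; lia.
have vanish0 : pencil w base_y 0 (q + q) = 0 ->
    forall r, (r < q.+1)%N -> w (0 * q.+1 + r)%N = 0.
  move=> e; apply: (@base_pencil_eq0 w 0 (iota q q.+1)).
  - exact: iota_uniq.
  - by rewrite size_iota.
  move=> j; rewrite mem_iota addnS ltnS (leq_eqVlt j) => /andP[qj /orP[/eqP->//|jq]].
  by apply: f0_hi; rewrite qj.
have vanish1 : pencil w base_y 1 (q + q) = 0 ->
    forall r, (r < q.+1)%N -> w (1 * q.+1 + r)%N = 0.
  move=> e; apply: (@base_pencil_eq0 w 1 ((q + q)%N :: iota 0 q)).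
  - by rewrite /= iota_uniq andbT mem_iota; lia.
  - by rewrite /= size_iota.
  move=> j; rewrite inE mem_iota => /orP[/eqP->//|/andP[_ jq]].
  exact: f1_lo.
have pencil0 a j : (forall r, (r < q.+1)%N -> w (a * q.+1 + r)%N = 0) ->
    pencil w base_y a j = 0.
  by move=> w0; rewrite /pencil big1 // => r _; rewrite w0 // mul0r.
have [w0 w1] : (forall r, (r < q.+1)%N -> w (0 * q.+1 + r)%N = 0) /\
    (forall r, (r < q.+1)%N -> w (1 * q.+1 + r)%N = 0).
  have [iq|qi] := ltnP i q.
    have w0 : forall r, (r < q.+1)%N -> w (0 * q.+1 + r)%N = 0.
      apply: (@base_pencil_eq0 w 0 (i :: iota q q)).
      - by rewrite /= iota_uniq andbT mem_iota; lia.
      - by rewrite /= size_iota.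
      by move=> j; rewrite inE mem_iota => /orP[/eqP->//|]; exact: f0_hi.
    by split=> //; apply: vanish1; rewrite -last_eq pencil0.
  have [iq2|iq2] := ltnP i (q + q).
    have w1 : forall r, (r < q.+1)%N -> w (1 * q.+1 + r)%N = 0.
      apply: (@base_pencil_eq0 w 1 (i :: iota 0 q)).
      - by rewrite /= iota_uniq andbT mem_iota; lia.
      - by rewrite /= size_iota.
      by move=> j; rewrite inE mem_iota => /orP[/eqP->//|/andP[_]]; exact: f1_lo.
    by split=> //; apply: vanish0; rewrite last_eq pencil0.
  have iE : i = (q + q)%N by lia.
  by rewrite -iE in vanish0 vanish1; split; [exact: vanish0 | exact: vanish1].
case/eqP: v0; rewrite -wE; apply/rowP => r; rewrite !mxE.
have [rq|rq] := ltnP r q.+1; first by have := w0 r rq.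
have := w1 (r - q.+1)%N; rewrite mul1n subnKC //; apply.
by have := ltn_ord r; lia.
Qed.
End BaseConfiguration.
End BinaryForms.

(** * Secant spaces and tensors on rational curves *)

(** The functions [a], [b] and [c] give for each coordinate of the ambient space
    the indices of its monomial in the three factors. *)
Section TensorsOnCurves.
Variables (K : numFieldType) (N q d n : nat).
Variables (a b c : 'I_N.+1 -> nat).
Hypotheses (alt : forall k, (a k < 2)%N) (ble : forall k, (b k <= d)%N)
  (clt : forall k, (c k < n.+1)%N).
Local Open Scope ring_scope.
Local Notation h := (q + q.+1)%N.

(** The general element of the span of C x P^n, for C the graph of the pair of
    forms with coefficients [w]: the linear functional [u] on the forms of
    bidegree (d + q, 1), applied to [f_a * g * t] where [g] and [t] are monomials
    of the second and third factors. *)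
Definition curve_tensor (A : nzRingType) (w : nat -> A) (u : nat -> nat -> A)
    (k : 'I_N.+1) : A :=
  \sum_(s < q.+1) w (a k * q.+1 + s)%N * u (b k + s)%N (c k).

Definition secant_tensor (A : nzRingType) (x y z : nat -> nat -> A)
    (k : 'I_N.+1) : A :=
  \sum_(i < h) x i (a k) * (y i 0%N ^+ (d - b k) * y i 1%N ^+ b k) * z i (c k).

(** Once [x i] is proportional to the value of the pair of forms at [y i], the
    functional [u] is the combination of the evaluations at the points [y i]
    with values in the vectors [z i]. *)
Lemma secant_tensor_on_curve (w : nat -> K) (mu : nat -> K)
    (x y z : nat -> nat -> K) :
  (forall i r, (i < h)%N -> (r < 2)%N -> x i r = mu i * pencil q w y r i) ->
  secant_tensor x y z =1 curve_tensor w (fun m r =>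
    \sum_(i < h) mu i * (y i 0%N ^+ (d + q - m) * y i 1%N ^+ m) * z i r).
Proof.
move=> xE k; rewrite /curve_tensor.
under [RHS]eq_bigr => s _ do rewrite mulr_sumr.
rewrite exchange_big; apply: eq_bigr => i _.
rewrite xE // /pencil mulr_sumr !mulr_suml; apply: eq_bigr => s _.
have -> : (d + q - (b k + s) = (d - b k) + (q - s))%N.
  by have := ble k; have := ltn_ord s; lia.
by rewrite /bimonom !exprD; ring.
Qed.

(** Only [x] and [y] move along the line to the base configuration. The product
    [P] of the determinants is a nonzero polynomial in the parameter of the line,
    since it does not vanish at the base configuration. *)
Lemma secant_tensor_vanish (F : {mpoly K[N.+1]}) :
  (forall w u, F.@[@curve_tensor K w u] = 0) ->
  forall x y z, F.@[@secant_tensor K x y z] = 0.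
Proof.
move=> Fcurve x y z.
pose line (s e : nat -> nat -> K) i r : {poly K} :=
  (s i r)%:P + (e i r - s i r) *: 'X.
have line0 s e i r : (line s e i r).[0] = s i r.
  by rewrite /line hornerD hornerC hornerZ hornerX mulr0 addr0.
have line1 s e i r : (line s e i r).[1] = e i r.
  by rewrite /line hornerD hornerC hornerZ hornerX mulr1 addrC subrK.
pose X := line x (base_x q K); pose Y := line y (base_y K).
pose P := \prod_(i < h) \det (incidence_mx q X Y i).
have P0 : P != 0.
  apply: contraTneq isT => P0; have : P.[1] = 0 by rewrite P0 horner0.
  move=> /eqP; rewrite horner_prod => /prodf_eq0[i _] /idPn[].
  rewrite horner_incidence_mx.
  rewrite (_ : incidence_mx _ _ _ _ = incidence_mx q (base_x q K) (base_y K) i).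
    exact: base_generic.
  by congr incidence_mx; apply/funext => j; apply/funext => r; rewrite line1.
have evT t k : (secant_tensor X Y (fun i r => (z i r)%:P) k).[t] =
    secant_tensor (fun i r => (X i r).[t]) (fun i r => (Y i r).[t]) z k.
  rewrite horner_sum; apply: eq_bigr => i _.
  by rewrite !hornerM !horner_exp hornerC.
have := meval_curve_eq0 (F := F) (c := secant_tensor X Y (fun i r => (z i r)%:P)) P0.
move=> /(_ _ 0) <-.
  apply: meval_eq => k; rewrite evT; apply: eq_bigr => i _.
  by rewrite /X /Y !line0.
move=> t; rewrite horner_prod => /prodf_neq0 Pt.
rewrite (meval_eq (v2 := secant_tensor (fun i r => (X i r).[t])
  (fun i r => (Y i r).[t]) z)) => [|k]; last exact: evT.
have [i ih|w] :=
  @pencil_through q K (fun i r => (X i r).[t]) (fun i r => (Y i r).[t]).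
  by have := Pt (Ordinal ih) isT; rewrite horner_incidence_mx.
move=> wP.
have [mu muE] : exists mu : nat -> K, forall i r, (i < h)%N -> (r < 2)%N ->
    (X i r).[t] = mu i * pencil q w (fun i r => (Y i r).[t]) r i.
  have /choice[mu muE] : forall i, exists mu, (i < h)%N -> forall r, (r < 2)%N ->
      (X i r).[t] = mu * pencil q w (fun i r => (Y i r).[t]) r i.
    move=> i; have [/wP[mu muE]|_] := boolP (i < h)%N; first by exists mu.
    by exists 0.
  by exists mu => i r ih r2; exact: muE.
by rewrite (meval_eq _ (secant_tensor_on_curve z muE)).
Qed.

Local Notation D := ((d + q.+1) * n.+1)%N.

(** The last coefficient of [w], of index [h], and the last coordinate of [u], of
    index [D.-1] once the pairs of indices are flattened, are set to 1; the [h]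
    other coefficients and the [D.-1] other coordinates are the variables. *)
Definition nparam := (h + D.-1)%N.

(** An index out of range yields 1, which normalizes the last coordinate of [u]. *)
Definition affine_var r : {mpoly K[nparam]} :=
  if insub r is Some i then 'X_i else 1.

Definition affine_curve_tensor : N.+1.-tuple {mpoly K[nparam]} :=
  [tuple curve_tensor (fun r => if (r < h)%N then affine_var r else 1)
     (fun m r => affine_var (h + (m * n.+1 + r))) k | k < N.+1].

(** When both last coordinates are nonzero, dividing [w] and [u] by them rescales
    the tensor; adding the parameter [t] to all coordinates makes them nonzero for
    almost all [t]. *)
Lemma affine_curve_tensorP e (F : {mpoly K[N.+1]}) : F \is e.-homog ->
  (forall v : 'I_nparam -> K, F.@[fun k => (tnth affine_curve_tensor k).@[v]] = 0) ->
  forall w u, F.@[@curve_tensor K w u] = 0.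
Proof.
move=> Fe Faff.
have generic (w : nat -> K) (u : nat -> nat -> K) : w h != 0 -> u (d + q)%N n != 0 ->
    F.@[curve_tensor w u] = 0.
  move=> w0 u0.
  pose v (i : 'I_nparam) := if (i < h)%N then w i / w h else
    u ((i - h) %/ n.+1)%N ((i - h) %% n.+1)%N / u (d + q)%N n.
  rewrite (meval_eq (v2 := fun k => (w h * u (d + q)%N n) *
      (tnth affine_curve_tensor k).@[v])).
    by rewrite (meval_homogZ _ _ Fe) Faff mulr0.
  move=> k; rewrite tnth_mktuple /curve_tensor raddf_sum mulr_sumr.
  apply: eq_bigr => s _; rewrite /= mevalM.
  have wE : (if (a k * q.+1 + s < h)%N then affine_var (a k * q.+1 + s) else 1).@[v]
      = w (a k * q.+1 + s)%N / w h.
    case: ifP => ih.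
      rewrite /affine_var insubT /=; first by rewrite /nparam; lia.
      by move=> ip; rewrite mevalXU /v /= ih.
    have -> : (a k * q.+1 + s = h)%N.
      by move: (a k) (alt k) ih => [|[|//]] _; have := ltn_ord s; lia.
    by rewrite meval1 divff.
  have uE : (affine_var (h + ((b k + s) * n.+1 + c k))).@[v] =
      u (b k + s)%N (c k) / u (d + q)%N n.
    rewrite /affine_var; case: insubP => [i _ iE|].
      rewrite mevalXU /v iE ltnNge leq_addr /= addKn.
      by rewrite divnMDl // modnMDl divn_small // modn_small // addn0.
    rewrite /nparam -leqNgt; have := clt k; have := ble k; have := ltn_ord s.
    move=> sq bd cn; rewrite leq_add2l.
    (* the only index out of range is that of the coordinate set to 1 *)
    move=> big; have [-> ->] : (b k + s = d + q)%N /\ c k = n by nia.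
    by rewrite meval1 divff.
  by rewrite wE uE; field; rewrite w0 u0.
move=> w u.
pose W r : {poly K} := (w r)%:P + 'X; pose U m r : {poly K} := (u m r)%:P + 'X.
pose P := W h * U (d + q)%N n.
have shift0 (x : K) : x%:P + 'X != 0 by rewrite addrC -size_poly_gt0 size_XaddC.
have P0 : P != 0 by rewrite mulf_neq0 // shift0.
have evT t k : (curve_tensor W U k).[t] =
    curve_tensor (fun r => (W r).[t]) (fun m r => (U m r).[t]) k.
  by rewrite horner_sum; apply: eq_bigr => s _; rewrite hornerM.
have <- := meval_curve_eq0 (F := F) (c := curve_tensor W U) P0 _ 0.
  apply: meval_eq => k; rewrite evT; apply: eq_bigr => i _.
  by rewrite !hornerD !hornerC !hornerX !addr0.
move=> t; rewrite hornerM mulf_eq0 negb_or => /andP[Wt Ut].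
by rewrite (meval_eq _ (evT t)) generic.
Qed.

End TensorsOnCurves.

(** * Chains of irreducible subsets of Segre-Veronese varieties *)

Section Irreducibility.
Variables (K : numFieldType) (N : nat).
Local Open Scope ring_scope.
Local Notation ev c t := (\row_k (c k).[t]).

(** If forms [f] and [g] vanish on the two parts of a closed cover of [Z] without
    vanishing on [Z], the product of their restrictions to a curve through a point
    where [f] is nonzero and a point where [g] is nonzero is the zero polynomial,
    which is absurd. The curve may pass through the origin, where it defines no
    point of [Z]; multiplying by one of its coordinates covers this case. *)
Lemma zirreducible_of_curves (Z : set (proj K N)) : (Z !=set0)%classic ->
  (forall p q, Z p -> Z q -> exists c : 'I_N.+1 -> {poly K},
     [/\ val p = <[ev c 0]>%VS, val q = <[ev c 1]>%VS &
       forall t, ev c t != 0 -> exists2 s, Z s & val s = <[ev c t]>%VS]) ->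
  zirreducible Z.
Proof.
move=> Z0 Zcurve; split=> // A B [A' [SA SAh ->] ->] [B' [SB SBh ->] ->] ZAB.
have [ZA|/existsNP[p /not_implyP[Zp nAp]]] :=
  pselect (forall p, Z p -> forall f, SA f -> vanish_at f p).
  by left; apply/seteqP; split=> p //= Zp; [split=> //; exact: ZA | case: Zp].
have [ZB|/existsNP[q /not_implyP[Zq nBq]]] :=
  pselect (forall p, Z p -> forall f, SB f -> vanish_at f p).
  by right; apply/seteqP; split=> p' //= Zp'; [split=> //; exact: ZB | case: Zp'].
move: nAp => /existsNP[f /not_implyP[Sf nfp]].
move: nBq => /existsNP[g /not_implyP[Sg ngq]].
have [df fh] := SAh f Sf; have [dg gh] := SBh g Sg.
have [c [pE qE cZ]] := Zcurve p q Zp Zq.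
have [F FE] := mpoly_curve f c; have [G GE] := mpoly_curve g c.
have evE (u : {mpoly K[N.+1]}) t :
    u.@[(ev c t) 0] = u.@[fun k => (c k).[t]].
  by apply: meval_eq => k; rewrite mxE.
have F0 : F != 0.
  apply: contra_notN nfp => /eqP F0; apply/(vanish_at_line fh pE).
  by rewrite evE -FE F0 horner0.
have G0 : G != 0.
  apply: contra_notN ngq => /eqP G0; apply/(vanish_at_line gh qE).
  by rewrite evE -GE G0 horner0.
have [k ck] : exists k, c k != 0.
  have : ev c 0 != 0.
    by have := valP p; rewrite pE dim_vline eqb1.
  apply: contraNP => /forallNP ck; apply/eqP/rowP => k; rewrite !mxE.
  by have /negP := ck k; rewrite negbK => /eqP ->; rewrite horner0.
suff /eqP : F * G * c k = 0 by rewrite !mulf_eq0 (negPf F0) (negPf G0) (negPf ck).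
apply: poly_eq0_fun => t; rewrite !hornerM FE GE -!evE.
have [ct0|ct0] := eqVneq (ev c t) 0.
  by move/rowP/(_ k): ct0; rewrite !mxE => ->; rewrite mulr0.
have [s Zs sE] := cZ t ct0.
have : Z s by []; rewrite ZAB => -[[_ As]|[_ Bs]].
  by have /(vanish_at_line fh sE)-> := As f Sf; rewrite !mul0r.
by have /(vanish_at_line gh sE)-> := Bs g Sg; rewrite mulr0 mul0r.
Qed.
End Irreducibility.

Section Coordinates.
Variables (r : nat) (n d : r.-tuple nat).
Local Open Scope ring_scope.
Local Notation N := (SVN n d).

Definition expo (k : 'I_N.+1) (i : 'I_r) (j : 'I_(tnth n i).+1) : nat :=
  tnth (val (SV_monom k i)) j.

Lemma sum_expo k i : (\sum_(j < (tnth n i).+1) expo k j = tnth d i)%N.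
Proof.
have /eqP <- := valP (SV_monom k i).
by rewrite big_tuple.
Qed.

(** [SV_map] in the coordinates of the points, over any commutative ring: over
    polynomials it describes curves on the variety. Indexing the coordinates by
    natural numbers removes the dependency of their range on the factor. *)
Definition SV_coord (A : comNzRingType) (X : 'I_r -> nat -> A) (k : 'I_N.+1) : A :=
  \prod_i \prod_(j < (tnth n i).+1) X i j ^+ expo k j.

Lemma SV_map_coord (K : fieldType) (x : forall i, 'rV[K]_(tnth n i).+1) :
  SV_map d x = \row_k SV_coord (fun i l => x i 0 (inord l)) k.
Proof.
apply/rowP => k; rewrite !mxE; apply: eq_bigr => i _.
by apply: eq_bigr => j _; rewrite inord_val.
Qed.

Lemma SV_coord_map (K : fieldType) (X : 'I_r -> nat -> K) :
  \row_k SV_coord X k = SV_map d (fun i => \row_j X i j).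
Proof.
apply/rowP => k; rewrite !mxE; apply: eq_bigr => i _.
by apply: eq_bigr => j _; rewrite mxE.
Qed.

(** These monomials detect which coordinates of a point of the product are
    nonzero. *)
Lemma pure_monom (j : 'I_r -> nat) : (forall i, j i <= tnth n i)%N ->
  exists k, forall i (l : 'I_(tnth n i).+1),
    expo k l = if (l == j i :> nat) then tnth d i else 0%N.
Proof.
move=> jn.
pose t i : (tnth n i).+1.-tuple 'I_(tnth d i).+1 :=
  [tuple if (l == j i :> nat) then ord_max else ord0 | l < (tnth n i).+1].
have tP i : (\sum_(l <- t i) l == tnth d i)%N.
  rewrite big_tuple (bigD1 (inord (j i))) //= tnth_mktuple inordK ?ltnS // eqxx /=.
  rewrite big1 ?addn0 // => l lj; rewrite tnth_mktuple ifN //.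
  by apply: contraNneq lj => lj; apply/eqP/val_inj; rewrite /= inordK ?ltnS // lj.
pose mu : multimonom n d := [ffun i => exist _ (t i) (tP i)].
exists (cast_ord (card_multimonom n d) (enum_rank mu)) => i l.
rewrite /expo /SV_monom cast_ordK enum_rankK ffunE /= tnth_mktuple.
by case: ifP.
Qed.

Lemma SV_coord_pure (A : comNzRingType) (X : 'I_r -> nat -> A) (j : 'I_r -> nat) k :
  (forall i, j i <= tnth n i)%N ->
  (forall i (l : 'I_(tnth n i).+1),
     expo k l = if (l == j i :> nat) then tnth d i else 0%N) ->
  SV_coord X k = \prod_i X i (j i) ^+ tnth d i.
Proof.
move=> jn kE; apply: eq_bigr => i _.
rewrite (bigD1 (inord (j i))) //= kE inordK ?ltnS // eqxx.
rewrite big1 ?mulr1 // => l lj; rewrite kE ifN ?expr0 //.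
by apply: contraNneq lj => lj; apply/eqP/val_inj; rewrite /= inordK ?ltnS // lj.
Qed.
End Coordinates.

Section Boxes.
Variables (K : numFieldType) (r : nat) (n d : r.-tuple nat).
Hypothesis dpos : forall i, (0 < tnth d i)%N.
Local Open Scope ring_scope.
Local Notation N := (SVN n d).
Implicit Types (b : 'I_r -> nat) (x : forall i : 'I_r, 'rV[K]_(tnth n i).+1).

Lemma SV_map_neq0 x : (SV_map d x != 0) = [forall i, x i != 0].
Proof.
apply/idP/forallP => [x0 i|x0].
  apply: contraNneq x0 => xi0; apply/eqP/rowP => k; rewrite !mxE.
  apply/eqP; rewrite prodf_seq_eq0; apply/hasP; exists i; first exact: mem_index_enum.
  have /eqP := sum_expo k i; apply: contraTT => /= xk.
  rewrite big1 ?ltn_eqF // => j _.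
  apply/eqP; apply: contraNT xk => kj; rewrite (bigD1 j) //= xi0 mxE.
  by rewrite expr0n -/(expo k j) (negPf kj) mul0r.
have /choice[j jP] : forall i, exists j, (j <= tnth n i)%N /\ x i 0 (inord j) != 0.
  by move=> i; have /rV0Pn[l xl] := x0 i; exists l; rewrite -ltnS ltn_ord inord_val.
have [k kE] := pure_monom d (fun i => (jP i).1).
apply/eqP => /rowP/(_ k); rewrite SV_map_coord !mxE.
rewrite (SV_coord_pure _ (fun i => (jP i).1) kE) => /eqP/prodf_eq0[i _].
by rewrite expf_eq0 dpos (negPf (jP i).2).
Qed.

(** The image of the product of the coordinate subspaces of dimensions [b i]. *)
Definition box b : set (proj K N) :=
  [set p | exists x, [/\ forall i, x i != 0,
    forall i (l : 'I_(tnth n i).+1), (b i < l)%N -> x i 0 l = 0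
    & val p = <[SV_map d x]>%VS]]%classic.

Lemma box_point b : (forall i, b i <= tnth n i)%N ->
  exists2 p, box b p & exists2 k, (forall i (l : 'I_(tnth n i).+1),
    expo k l = if (l == b i :> nat) then tnth d i else 0%N)
    & ~ vanish_at 'X_k p.
Proof.
move=> bn; pose x (i : 'I_r) : 'rV[K]_(tnth n i).+1 := \row_l (l == b i :> nat)%:R.
have x0 i : x i != 0.
  apply/eqP => /rowP/(_ (inord (b i))); rewrite !mxE inordK ?ltnS // eqxx.
  by move/eqP; rewrite oner_eq0.
have Sx0 : SV_map d x != 0 by rewrite SV_map_neq0; apply/forallP.
have [p pE] := proj_of_vec Sx0; exists p.
  exists x; split=> // i l bl; rewrite mxE.
  by case: eqP bl => // ->; rewrite ltnn.
have [k kE] := pure_monom d bn; exists k => //.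
have Xk := homogX K k.
rewrite (vanish_at_line Xk pE) mevalXU SV_map_coord mxE.
rewrite (SV_coord_pure _ bn kE) big1 => [|i _]; first by move/eqP; rewrite oner_eq0.
by rewrite mxE inordK ?ltnS // eqxx expr1n.
Qed.

Lemma box_vanish b p k i (l : 'I_(tnth n i).+1) : box b p -> (b i < l)%N ->
  (0 < expo k l)%N -> vanish_at 'X_k p.
Proof.
move=> [x [_ xb pE]] bl kl.
have Xk := homogX K k.
apply/(vanish_at_line Xk pE); rewrite mevalXU mxE.
rewrite (bigD1 i) //= (bigD1 l) //= xb // expr0n -/(expo k l).
by rewrite eqn0Ngt kl /= !mul0r.
Qed.

(** If [x] is not in the box, the pure monomial at the last nonzero coordinates
    of the [x i] involves a forbidden coordinate and does not vanish at [x]. *)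
Lemma box_closed b : closed_in (SV K n d) (box b).
Proof.
exists [set p | forall f, (exists k i (l : 'I_(tnth n i).+1),
    [/\ (b i < l)%N, (0 < expo k l)%N & f = 'X_k]) -> vanish_at f p]%classic.
  eexists; last reflexivity.
  by move=> f [k [i [l [_ _ ->]]]]; exists 1%N; exact: homogX.
apply/seteqP; split=> p /=.
  move=> bp; split; first by have [x [x0 _ pE]] := bp; exists x.
  by move=> f [k [i [l [bl kl ->]]]]; exact: box_vanish bp bl kl.
move=> [[x x0 pE] pX]; exists x; split=> // i l bl.
apply/eqP; apply/negPn/negP => xl.
have /choice[j jP] : forall i, exists j, [/\ (j <= tnth n i)%N,
    x i 0 (inord j) != 0 & forall l, x i 0 l != 0 -> (l <= j)%N].
  move=> i'; have /rV0Pn[l0 xl0] := x0 i'.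
  case: (arg_maxnP (P := fun l => x i' 0 l != 0) (fun l => l : nat) xl0) => m xm mmax.
  by exists m; rewrite inord_val -ltnS ltn_ord; split=> // l' /mmax.
have jn i' : (j i' <= tnth n i')%N by case: (jP i').
have [k kE] := pure_monom d jn.
have Xk := homogX K k.
have : vanish_at 'X_k p.
  apply: pX; exists k, i, (inord (j i)); rewrite kE inordK ?ltnS // eqxx dpos.
  by split=> //; apply: leq_trans bl _; have [_ _] := jP i; exact.
rewrite (vanish_at_line Xk pE) mevalXU SV_map_coord mxE.
rewrite (SV_coord_pure _ jn kE) => /eqP/prodf_eq0[i' _].
by rewrite expf_eq0; case: (jP i') => _ /negPf-> _; rewrite andbF.
Qed.

(** Two points of the product of coordinate subspaces are joined by a line. *)
Lemma box_zirreducible b : (forall i, b i <= tnth n i)%N -> zirreducible (box b).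
Proof.
move=> bn; apply: zirreducible_of_curves.
  by have [p bp _] := box_point bn; exists p.
move=> p q [x [x0 xb pE]] [y [y0 yb qE]].
pose X i l : {poly K} :=
  (x i 0 (inord l))%:P + (y i 0 (inord l) - x i 0 (inord l)) *: 'X.
have Xt t : \row_k (SV_coord (n := n) (d := d) X k).[t] =
    SV_map d (fun i => \row_l (X i l).[t]).
  rewrite -(@SV_coord_map _ n d _ (fun i l => (X i l).[t])).
  apply/rowP => k; rewrite !mxE horner_prod.
  apply: eq_bigr => i _; rewrite horner_prod; apply: eq_bigr => l _.
  by rewrite horner_exp.
exists (SV_coord (n := n) X); split.
- rewrite pE Xt !SV_map_coord; congr (<[ _ ]>%VS); apply/rowP => k; rewrite !mxE.
  apply: eq_bigr => i _; apply: eq_bigr => l _.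
  by rewrite mxE inord_val hornerD hornerC hornerZ hornerX mulr0 addr0 inord_val.
- rewrite qE Xt !SV_map_coord; congr (<[ _ ]>%VS); apply/rowP => k; rewrite !mxE.
  apply: eq_bigr => i _; apply: eq_bigr => l _.
  by rewrite mxE inord_val hornerD hornerC hornerZ hornerX mulr1 addrC subrK inord_val.
move=> t; rewrite Xt => Xt0; have [s sE] := proj_of_vec Xt0; exists s => //.
exists (fun i => \row_l (X i l).[t]); split=> //.
  by apply/forallP; rewrite -SV_map_neq0.
move=> i l bl; rewrite mxE hornerD hornerC hornerZ inord_val.
by rewrite xb // yb // subrr mul0r addr0.
Qed.

Lemma SV_chain (b : nat -> 'I_r -> nat) m :
  (forall j i, b j i <= tnth n i)%N ->
  (forall j i, b j i <= b j.+1 i)%N ->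
  (forall j, (j < m)%N -> exists i, (b j i < b j.+1 i)%N) ->
  irr_chain (SV K n d) m.
Proof.
move=> bn bS blt; exists (fun j => box (b j)); split=> j jm.
  by split; [exact: box_closed | exact: box_zirreducible].
split=> [p [x [x0 xb pE]]|sub].
  by exists x; split=> // i l bl; apply: xb; exact: leq_ltn_trans (bS j i) bl.
have [i bi] := blt j jm.
have [p /sub bp [k kE []]] := box_point (bn j.+1).
have lE : (inord (b j.+1 i) : 'I_(tnth n i).+1) = b j.+1 i :> nat.
  by rewrite inordK ?ltnS.
apply: (box_vanish (i := i) (l := inord (b j.+1 i)) bp); first by rewrite lE.
by rewrite kE lE eqxx.
Qed.
End Boxes.

(** * Defectivity of P^1 x P^1 x P^n embedded by O(1, d, 1) *)

Section PointChain.
Variables (K : fieldType) (N : nat).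
Local Open Scope ring_scope.

Lemma zclosed_point (p : proj K N) : zclosed [set p]%classic.
Proof.
have [v v0 pE] := proj_rep p.
pose minor i j : {mpoly K[N.+1]} := v 0 j *: 'X_i - v 0 i *: 'X_j.
have minorh i j : minor i j \is 1.-homog.
  by apply: rpredB; apply: dhomogZ; exact: homogX.
exists [set f | exists i j, f = minor i j]%classic.
  by move=> f [i [j ->]]; exists 1%N.
apply/seteqP; split=> s /=.
  move=> -> f [i [j ->]]; apply/(vanish_at_line (minorh i j) pE).
  by rewrite mevalB !mevalZ !mevalXU mulrC subrr.
move=> s_minors; have [w w0 sE] := proj_rep s.
have /rV0Pn[j vj] := v0.
have wE : w = (w 0 j / v 0 j) *: v.
  apply/rowP => i; rewrite mxE mulrAC.
  have /(vanish_at_line (minorh i j) sE) : vanish_at (minor i j) s.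
    by apply: s_minors; exists i, j.
  rewrite mevalB !mevalZ !mevalXU => /eqP; rewrite subr_eq0 => /eqP ij.
  by rewrite [_ * v 0 i]mulrC -ij mulrC mulKf.
apply: val_inj; apply/eqP; rewrite sE pE eqEdim !dim_vline v0 w0 leqnn andbT.
by rewrite -memvE wE memvZ // memv_line.
Qed.

(** A chain of length 0 is needed for the dimension of a secant variety to
    exist. *)
Lemma irr_chain_point (Y : set (proj K N)) p : Y p -> irr_chain Y 0.
Proof.
move=> Yp; exists (fun=> [set p]%classic); split=> // i _; split.
  exists [set p]%classic; first exact: zclosed_point.
  by apply/seteqP; split=> s /=; [move=> -> | case].
split=> [|A B [A' _ AE] [B' _ BE] AB]; first by exists p.
have : (A `|` B)%classic p by rewrite -AB.
have sub (C C' : set (proj K N)) : C = ([set p] `&` C')%classic -> C p ->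
    [set p]%classic = C.
  by move=> CE Cp; apply/seteqP; split=> s /=; [move=> -> | rewrite CE => -[]].
by move=> [Ap|Bp]; [left; exact: sub AE Ap | right; exact: sub BE Bp].
Qed.

Lemma sub_secant h (X : set (proj K N)) p : (0 < h)%N -> X p -> secant h X p.
Proof.
move=> h0 Xp A [_]; apply; exists (fun=> p) => //.
exact: (sumv_sup (Ordinal h0)).
Qed.
End PointChain.

Section Coordinates3.
Local Open Scope ring_scope.

(** A monomial of degree 1 is a variable, and one of degree [D] in two variables
    is given by one exponent. The index is chosen independently of the ring, so
    that it is the same for points and for curves. *)
Lemma linear_monomial m (e : 'I_m.+1 -> nat) : (\sum_j e j = 1)%N ->
  exists2 a, (a < m.+1)%N &
    forall (A : comNzRingType) (X : nat -> A), \prod_(j < m.+1) X j ^+ e j = X a.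
Proof.
move=> e1; have [j ej] : exists j, e j != 0%N.
  apply/existsP; apply: contra_eqT e1 => /existsPn e0.
  by rewrite big1 // => j _; apply/eqP; move: (e0 j); rewrite negbK.
exists j => // A X; move: e1; rewrite (bigD1 j) //= => e1.
have ej1 : e j = 1%N by lia.
rewrite (bigD1 j) //= ej1 expr1 big1 ?mulr1 // => i ij.
move: e1; rewrite ej1 (bigD1 i) //= => e1.
by rewrite (_ : e i = 0%N) //; lia.
Qed.

Lemma binary_monomial D (e : 'I_2 -> nat) : (\sum_j e j = D)%N ->
  exists2 b, (b <= D)%N & forall (A : comNzRingType) (X : nat -> A),
    \prod_(j < 2) X j ^+ e j = X 0%N ^+ (D - b) * X 1%N ^+ b.
Proof.
rewrite !big_ord_recl big_ord0 addn0 => <-; exists (e (lift ord0 ord0)).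
  exact: leq_addl.
by move=> A X; rewrite !big_ord_recl big_ord0 mulr1 addnK.
Qed.

Lemma prod_ord3 (A : comNzRingType) (G : 'I_3 -> A) :
  \prod_i G i = G 0 * G 1 * G (1 + 1).
Proof.
rewrite !big_ord_recl big_ord0 mulr1 mulrA.
by congr (_ * G _ * G _); exact: val_inj.
Qed.

Variables (n d : nat).
Local Notation ns := [tuple 1; 1; n]%N.
Local Notation ds := [tuple 1; d; 1]%N.
Local Notation N := (SVN ns ds).

Lemma SVN_segre_veronese : N = ((2 * d.+1 * n.+1).-1)%N.
Proof.
rewrite /SVN !big_ord_recl big_ord0 muln1 -mulnA; congr (_ * (_ * _)).-1%N.
  exact: (binSn d).
by rewrite -[RHS]bin1 -[in RHS]addn1.
Qed.

Lemma SV_coord3 : exists a b c : 'I_N.+1 -> nat,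
  [/\ forall k, (a k < 2)%N, forall k, (b k <= d)%N, forall k, (c k < n.+1)%N &
    forall (A : comNzRingType) (X : 'I_3 -> nat -> A) k, SV_coord X k =
      X 0 (a k) * (X 1 0%N ^+ (d - b k) * X 1 1%N ^+ b k) * X (1 + 1) (c k)].
Proof.
have /choice[t tP] : forall k : 'I_N.+1, exists t : nat * nat * nat,
  [/\ (t.1.1 < 2)%N, (t.1.2 <= d)%N, (t.2 < n.+1)%N &
    forall (A : comNzRingType) (X : 'I_3 -> nat -> A), SV_coord X k =
      X 0 t.1.1 * (X 1 0%N ^+ (d - t.1.2) * X 1 1%N ^+ t.1.2) * X (1 + 1) t.2].
  move=> k.
  have [a a2 aE] := linear_monomial (sum_expo k 0).
  have [b bd bE] := binary_monomial (sum_expo k 1).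
  have [c cn cE] := linear_monomial (sum_expo k (1 + 1)).
  exists (a, b, c); split=> // A X.
  by apply: etrans (prod_ord3 _) _; rewrite aE bE cE.
exists (fun k => (t k).1.1), (fun k => (t k).1.2), (fun k => (t k).2).
by split=> [k|k|k|A X k]; case: (tP k).
Qed.

Variable K : numFieldType.

(** The box grows first in the third factor, then in the second and the first. *)
Lemma SV_chain3 : (0 < d)%N -> irr_chain (SV K ns ds) n.+2.
Proof.
move=> d0.
pose b (j : nat) (i : 'I_3) : nat :=
  nth 0%N [:: (n.+1 < j : nat); (n < j : nat); minn j n]%N i.
apply: (@SV_chain K 3 ns ds _ b).
- by move=> [[|[|[|//]]] ilt].
- by move=> j [[|[|[|//]]] ilt]; rewrite /b /tnth /=; lia.
- by move=> j [[|[|[|//]]] ilt]; rewrite /b /=; lia.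
move=> j jn; have [jn0|jn0] := ltnP j n; first by exists (1 + 1); rewrite /b /=; lia.
have [jn1|jn1] := leqP j n; first by exists 1; rewrite /b /=; lia.
by exists 0; rewrite /b /=; lia.
Qed.

(** The coefficients of a point in the span of [h] points of the variety are
    absorbed in the third factor. *)
Lemma secant_vanish q : exists phi : N.+1.-tuple {mpoly K[nparam q d n]},
  forall e (F : {mpoly K[N.+1]}), F \is e.-homog ->
    (forall v, F.@[fun k => (tnth phi k).@[v]] = 0) ->
    forall p, secant (q + q.+1) (SV K ns ds) p -> vanish_at F p.
Proof.
have [a [b [c [alt ble clt abcE]]]] := SV_coord3.
exists (affine_curve_tensor K q d n a b c) => e F Fe Fphi.
have Fsec := secant_tensor_vanish alt ble (affine_curve_tensorP alt ble clt Fe Fphi).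
apply: (zclosure_vanish Fe) => s [p pSV sp] v vs.
have /memv_sumP[u up ->] := subvP sp _ vs.
have /choice[lam lamE] : forall i : 'I_(q + q.+1), exists lx :
    K * (forall i : 'I_3, 'rV[K]_(tnth ns i).+1), u i = lx.1 *: SV_map ds lx.2.
  move=> i; have [x _ xE] := pSV i; move: (up i isT); rewrite xE => /vlineP[l uE].
  by exists (l, x).
have h0 : (0 < q + q.+1)%N by rewrite addnS.
pose o j := insubd (Ordinal h0) j : 'I_(q + q.+1).
pose X (j : nat) (i : 'I_3) l := (lam (o j)).2 i 0 (inord l).
rewrite -[RHS](Fsec (fun j l => X j 0 l) (fun j l => X j 1 l)
  (fun j l => (lam (o j)).1 * X j (1 + 1) l)).
apply: meval_eq => k; rewrite summxE; apply: eq_bigr => j _.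
rewrite lamE mxE SV_map_coord mxE abcE /X /o valKd.
by rewrite mulrC -!mulrA; congr (_ * (_ * (_ * _))); rewrite mulrC.
Qed.

(** The variety is contained in its secant variety, so its dimension is bounded
    as well; hence it exists, and the chain of [SV_chain3] shows that it is at
    least [n.+2]. *)
Theorem segre_veronese_defective q : (0 < d)%N ->
  (nparam q d n <
     minn (n.+2 * (q + q.+1) + (q + q.+1) - 1) (2 * d.+1 * n.+1).-1)%N ->
  defective (SV K ns ds) (q + q.+1).
Proof.
move=> d0 lt_expected; set X := SV K ns ds; set h := (q + q.+1)%N in lt_expected *.
have [phi phiV] := secant_vanish q.
have h0 : (0 < h)%N by rewrite /h addnS.
have chainX := SV_chain3 d0; have [p Xp] : exists p, X p.
  have [Z [/(_ 0%N isT)[[A _ ZE] [[p Zp] _]] _]] := chainX.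
  by exists p; move: Zp; rewrite ZE => -[].
have secb k : irr_chain (secant h X) k -> (k <= nparam q d n)%N.
  by apply: (irr_chain_param (phi := phi)) => e F Fe Fphi s; exact: phiV Fe Fphi s.
have Xb k : irr_chain X k -> (k <= nparam q d n)%N.
  apply: (irr_chain_param (phi := phi)) => e F Fe Fphi s Xs.
  by apply: (phiV e F Fe Fphi); exact: sub_secant.
have [dX dXP /andP[ndX _]] := has_dim_exists chainX Xb.
have [dS dSP /andP[_ dSb]] :=
  has_dim_exists (irr_chain_point (sub_secant h0 Xp)) secb.
exists dX, dS; split=> //; apply: leq_ltn_trans dSb _.
apply: leq_trans lt_expected _; rewrite /expected_dim SVN_segre_veronese leq_min.
rewrite geq_minr andbT geq_min; apply/orP; left; apply: leq_sub2r.
by rewrite leq_add2r leq_mul2r ndX orbT.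
Qed.
End Coordinates3.

Theorem proposition6p6 (R : realType) (n d h : nat) :
  (n, d, h) \in [:: (3, 3, 5); (3, 6, 9); (3, 9, 13); (4, 4, 7); (4, 7, 11);
                    (5, 4, 7); (5, 5, 9)] ->
  defective (SV R[i] [tuple 1; 1; n] [tuple 1; d; 1]) h.
Proof.
rewrite !inE => /or4P[|||/or4P[]] /eqP[-> -> ->].
- exact: (@segre_veronese_defective 3 3 _ 2).
- exact: (@segre_veronese_defective 3 6 _ 4).
- exact: (@segre_veronese_defective 3 9 _ 6).
- exact: (@segre_veronese_defective 4 4 _ 3).
- exact: (@segre_veronese_defective 4 7 _ 5).
- exact: (@segre_veronese_defective 5 4 _ 3).
- exact: (@segre_veronese_defective 5 5 _ 4).
Qed.
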